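(* Let $G$ be a graph, let $\mathsf{B}(G)$ be the set of basic balanced measures on $G$, and let $\mathcal{B}(G)$ be the set of all balanced measures on $G$. Then for every strict subset $Q\subsetneq\mathsf{B}(G)$, there is no subcollection $\mathcal{T}\subseteq\mathcal{P}(Q)$ such that $\bigcup_{S\in\mathcal{T}}C(S)=\mathcal{B}(G)$, where $\mathcal{P}$ denotes the power set and $C$ the convex hull.
   Context: Every graph $G=(V,E)$ is finite, connected and simple with unit edge weights; $d(u,v)$ is the graph distance. A probability measure on $V$ is identified with a function $\mu:V\to\mathbb{R}_{\ge 0}$ with $\sum_{v\in V}\mu(v)=1$, hence with a point of $\mathbb{R}^n$ where $n=|V|$; convex hulls are taken in $\mathbb{R}^n$. The support is $\operatorname{spt}\mu=\{v\in V:\mu(v)>0\}$. The transport cost function is $T_\mu(v)=\sum_{u\in V}d(u,v)\mu(u)$, and the cost-maximizing set is $M_\mu=\{v\in V: T_\mu(v)=\max_{u\in V}T_\mu(u)\}$. A probability measure $\mu$ is balanced if $\operatorname{spt}\mu\subseteq M_\mu$. A probability measure $\mu$ is basic if for every probability measure $\nu\ne\mu$ on $V$ at least one of $\operatorname{spt}\mu\neq\operatorname{spt}\nu$ or $M_\mu\ne M_\nu$ holds. *)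

(* Defs.v *)
From mathcomp Require Import all_boot all_order all_algebra.
From mathcomp Require Import classical_sets reals convex.
Set Implicit Arguments.
Unset Strict Implicit.
Unset Printing Implicit Defensive.
Import Order.TTheory GRing.Theory Num.Theory.
Local Open Scope ring_scope.

Section Graph.
Variables (V : finType) (e : rel V).

Definition walk (k : nat) (u v : V) : bool :=
  [exists p : k.-tuple V, path e u p && (last u p == v)].

(* The length of a shortest walk. A shortest walk visits each vertex at most
   once, so only the lengths k < #|V| matter; the value is #|V| if there is no
   walk, which does not happen in a connected graph. *)
Definition dist (u v : V) : nat :=
  (\big[minn/#|V|]_(k < #|V| | walk k u v) k)%N.

Variable R : realType.

(* R^o is R as a module over itself: it makes {ffun V -> R^o} the vector space
   R^n with n = #|V|, as needed for convex hulls. *)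
Implicit Types mu nu : {ffun V -> R^o}.

Definition is_prob mu : Prop :=
  (forall v, 0 <= (mu v : R)) /\ \sum_v (mu v : R) = 1.

Definition spt mu : {set V} := [set v | 0 < (mu v : R)]%SET.

Definition transport_cost mu (v : V) : R := \sum_u (dist u v)%:R * (mu u : R).

(* The default value 0 of the iterated maximum is harmless for a probability
   measure, whose transport cost is nonnegative. *)
Definition cost_max mu : {set V} :=
  [set v | transport_cost mu v == \big[Num.max/0]_u transport_cost mu u]%SET.

Definition balanced mu : Prop := is_prob mu /\ spt mu \subset cost_max mu.

Definition basic mu : Prop :=
  is_prob mu /\
  forall nu, is_prob nu -> nu <> mu ->
    spt mu <> spt nu \/ cost_max mu <> cost_max nu.

End Graph.

Local Open Scope classical_set_scope.

Definition balanced_measures (V : finType) (e : rel V) (R : realType) :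
  set {ffun V -> R^o} := [set mu | balanced e mu].

Definition basic_balanced_measures (V : finType) (e : rel V) (R : realType) :
  set {ffun V -> R^o} := [set mu | basic e mu /\ balanced e mu].

Definition convex_hull (R : realType) (E : lmodType R) (S : set E) : set E :=
  smallest (@convex_set R E) S.

Arguments balanced_measures {V} e R.
Arguments basic_balanced_measures {V} e R.

(* Main.v *)
Require Import Defs.
From mathcomp Require Import all_boot all_order all_algebra.
From mathcomp Require Import classical_sets reals.
From mathcomp Require Import ring lra boolp interval_inference convex.
Import Order.TTheory GRing.Theory Num.Theory.
Local Open Scope classical_set_scope.
Local Open Scope ring_scope.
Local Open Scope convex_scope.

(** The proof shows that a basic balanced measure [mu] is an extreme point of
any convex set of balanced measures containing it ([basic_extreme]). If hulls
of subsets of [Q] cover exactly the balanced measures, then [mu] lies in some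
[convex_hull S] with [S] inside [Q], and this hull consists of balanced
measures. An extreme point of a hull belongs to the generating set
([extreme_mem_convex_hull]), so [mu] is in [Q]; hence [Q] contains every basic
balanced measure.

For extremality, let [mu] lie strictly inside a segment of balanced measures
with ends [a] and [b]. All interior points of the segment have support
[spt a :|: spt b] ([spt_mix]). They also have the same cost-maximizing set
[cost_max a :&: cost_max b], provided this intersection is nonempty
([cost_max_mix]). It is nonempty: take [v] in [spt a] and [w] in [spt b]. At
every interior point both are maximizers, so the costs of [v] and [w] agree;
these are affine functions of the parameter, and two values of the parameter
suffice to conclude that [v] and [w] are maximizers for both ends
([balanced_mix_common_max]). So another interior point shares both sets with
[mu], and since [mu] is basic it equals [mu]; the segment is a point. *)

Section Mixtures.
Variables (R : realType) (V : finType) (e : rel V).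
Implicit Types (a b mu : {ffun V -> R^o}) (s t : R).

Local Notation T := (transport_cost e).
Local Notation mix s a b := (s *: a + (1 - s) *: b).

Lemma mixE s a b v : (mix s a b) v = s * (a v : R) + (1 - s) * (b v : R).
Proof. by rewrite !ffunE. Qed.

Lemma transport_cost_mix s a b v :
  T (mix s a b) v = s * T a v + (1 - s) * T b v.
Proof.
rewrite /transport_cost !mulr_sumr -big_split /=; apply: eq_bigr => u _.
by rewrite mixE; ring.
Qed.

Lemma transport_cost_ge0 mu v : is_prob mu -> 0 <= T mu v.
Proof. by case=> mu0 _; apply: sumr_ge0 => u _; rewrite mulr_ge0. Qed.

Lemma cost_maxP mu v : is_prob mu ->
  reflect (forall u, T mu u <= T mu v) (v \in cost_max e mu).
Proof.
move=> Pmu; rewrite inE; apply: (iffP eqP) => [-> u|vmax].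
  exact: le_bigmax.
apply/le_anti; rewrite le_bigmax /=.
by apply: bigmax_le => [|u _]; [exact: transport_cost_ge0 | exact: vmax].
Qed.

Lemma spt_neq0 mu : is_prob mu -> exists v, v \in spt mu.
Proof.
case=> mu0 mu1; apply/existsP; apply: contraT; rewrite negb_exists => /forallP h.
suff : \sum_v (mu v : R) = 0 by rewrite mu1 => /eqP; rewrite oner_eq0.
apply: big1 => v _; apply/le_anti; rewrite mu0 andbT leNgt.
by have := h v; rewrite inE.
Qed.

Lemma spt_mix s a b : is_prob a -> is_prob b -> 0 < s -> s < 1 ->
  spt (mix s a b) = (spt a :|: spt b)%SET.
Proof.
move=> [a0 _] [b0 _] s0 s1; apply/setP => v; rewrite !inE mixE.
have s'0 : 0 < 1 - s by rewrite subr_gt0.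
have := a0 v; have := b0 v; rewrite !le_eqVlt => /predU1P[<-|bv] /predU1P[<-|av].
- by rewrite !mulr0 addr0 ltxx.
- by rewrite mulr0 addr0 ltxx orbF pmulr_rgt0.
- by rewrite mulr0 add0r ltxx pmulr_rgt0.
- by rewrite av; apply: addr_gt0; apply: mulr_gt0.
Qed.

(** A common maximizer attains the maximum of the mixed cost, and equality in
the mixed inequality forces equality in each term, as both weights are
positive. *)
Lemma cost_max_mix s a b v :
  is_prob a -> is_prob b -> is_prob (mix s a b) -> 0 < s -> s < 1 ->
  v \in cost_max e a -> v \in cost_max e b ->
  cost_max e (mix s a b) = (cost_max e a :&: cost_max e b)%SET.
Proof.
move=> Pa Pb Pm s0 s1 /(cost_maxP _ _ Pa) va /(cost_maxP _ _ Pb) vb.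
apply/setP => w; rewrite finset.in_setI; apply/(cost_maxP _ _ Pm)/andP.
  move/(_ v); rewrite !transport_cost_mix => hw.
  have := va w; have := vb w => hb ha.
  split; [apply/(cost_maxP _ _ Pa) => u; apply: le_trans (va u) _
         |apply/(cost_maxP _ _ Pb) => u; apply: le_trans (vb u) _]; nra.
case=> /(cost_maxP _ _ Pa) wa /(cost_maxP _ _ Pb) wb u.
rewrite !transport_cost_mix; have := wa u; have := wb u; nra.
Qed.

(** For [v] in [spt a] and [w] in [spt b], put [x = T a v - T a w >= 0] and
[y = T b w - T b v >= 0]. Balancedness at parameter [s] says that [v] and [w]
have equal cost there, that is [s * x = (1 - s) * y]. Subtracting this for two
parameters gives [x + y = 0]. *)
Lemma balanced_mix_common_max s t a b :
  balanced e a -> balanced e b ->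
  balanced e (mix s a b) -> balanced e (mix t a b) ->
  0 < s -> s < 1 -> 0 < t -> t < 1 -> s != t ->
  exists v, v \in cost_max e a /\ v \in cost_max e b.
Proof.
move=> [Pa Ba] [Pb Bb] Bs Bt s0 s1 t0 t1 st.
have [v va] := spt_neq0 _ Pa; have [w wb] := spt_neq0 _ Pb.
have vMa := fintype.subsetP Ba _ va; have wMb := fintype.subsetP Bb _ wb.
have eqT r : 0 < r -> r < 1 -> balanced e (mix r a b) ->
    r * T a v + (1 - r) * T b v = r * T a w + (1 - r) * T b w.
  move=> r0 r1 [Pr]; rewrite spt_mix // => /fintype.subsetP Br.
  have /(cost_maxP _ _ Pr) vM : v \in cost_max e (mix r a b).
    by apply: Br; rewrite inE va.
  have /(cost_maxP _ _ Pr) wM : w \in cost_max e (mix r a b).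
    by apply: Br; rewrite inE wb orbT.
  by rewrite -!transport_cost_mix; apply/le_anti; rewrite vM wM.
have Es := eqT _ s0 s1 Bs; have Et := eqT _ t0 t1 Bt.
have xy0 : T a v - T a w + (T b w - T b v) = 0.
  have st0 : s - t != 0 by rewrite subr_eq0.
  apply: (mulfI st0); rewrite mulr0; nra.
exists v; split => //; move/(cost_maxP _ _ Pa): vMa => vMa.
move/(cost_maxP _ _ Pb): wMb => wMb; apply/(cost_maxP _ _ Pb) => u.
have := vMa w; have := wMb u; lra.
Qed.

Lemma basic_extreme s a b :
  basic e (mix s a b) -> 0 < s -> s < 1 ->
  (forall t, 0 <= t -> t <= 1 -> balanced e (mix t a b)) -> a = b.
Proof.
move=> [_ basic_s] s0 s1 Bab.
have Ba : balanced e a.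
  by have := Bab 1; rewrite subrr scale1r scale0r addr0; apply.
have Bb : balanced e b.
  by have := Bab 0; rewrite subr0 scale1r scale0r add0r; apply.
pose t := s / 2.
have [t0 t1] : 0 < t /\ t < 1 by rewrite /t; lra.
have st : s != t by apply/eqP; rewrite /t => ?; lra.
have [Bs Bt] := (Bab _ (ltW s0) (ltW s1), Bab _ (ltW t0) (ltW t1)).
have [v [va vb]] := balanced_mix_common_max _ _ _ _ Ba Bb Bs Bt s0 s1 t0 t1 st.
have [Pa Pb Ps Pt] := And4 (proj1 Ba) (proj1 Bb) (proj1 Bs) (proj1 Bt).
have [//|ab] := pselect (a = b); exfalso.
have [| |] := basic_s _ Pt.
- move=> E; apply: ab; apply/ffunP => u; have := mixE t a b u.
  rewrite E mixE /t => Eu; apply/eqP.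
  by rewrite -(inj_eq (mulfI (lt0r_neq0 s0))); apply/eqP; lra.
- by rewrite !spt_mix.
- by rewrite (cost_max_mix _ _ _ _ Pa Pb Ps s0 s1 va vb)
             (cost_max_mix _ _ _ _ Pa Pb Pt t0 t1 va vb).
Qed.

End Mixtures.

Lemma convex_convex_hull (R : realType) (E : lmodType R) (S : set E) :
  convex_set (convex_hull S : set (convex_lmodType E)).
Proof.
move=> x y k /set_mem hx /set_mem hy; apply/mem_set => A [cA SA].
by apply/set_mem/cA; apply/mem_set; [apply: hx | apply: hy].
Qed.

(** Removing an extreme point from a convex set leaves a convex set. If [x] were
not in [S], the hull without [x] would be a smaller convex set containing
[S]. *)
Lemma extreme_mem_convex_hull (R : realType) (E : lmodType R) (S : set E)
    (x : E) :
  (forall (a b : convex_lmodType E) (k : {i01 R}),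
     convex_hull S a -> convex_hull S b -> 0 < k%:num -> k%:num < 1 ->
     x = a <| k |> b -> a = b) ->
  convex_hull S x -> S x.
Proof.
move=> extr hx; have [//|nSx] := pselect (S x); exfalso.
suff : (convex_hull S `\ x) x by case=> _; apply.
apply: hx; split=> [|y Sy]; last first.
  split; first exact: sub_gen_smallest.
  by move=> /= yx; apply: nSx; rewrite -yx.
apply/convex_setW => a b /set_mem[ha ax] /set_mem[hb bx] k k0 k1.
apply/mem_set; split.
  by apply/set_mem/convex_convex_hull; apply/mem_set.
move=> /= kx; have ab := extr a b k ha hb k0 k1 (esym kx).
by apply: ax; rewrite /= -kx -ab convmm.
Qed.

Theorem corollary2p13 (R : realType) (V : finType) (e : rel V)
    (e_sym : symmetric e) (e_irr : irreflexive e)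
    (e_conn : forall u v : V, connect e u v)
    (Q : set {ffun V -> R^o}) :
  Q `<` basic_balanced_measures e R ->
  ~ exists T : set (set {ffun V -> R^o}),
      T `<=` [set S | S `<=` Q] /\
      \bigcup_(S in T) convex_hull S = balanced_measures e R.
Proof.
move=> [_ nBQ] [T [TQ cover]]; apply: nBQ => mu [mu_basic mu_bal].
have : balanced_measures e R mu by [].
rewrite -cover => -[S TS muS].
have hull_bal nu : convex_hull S nu -> balanced e nu.
  by move=> nuS; have : balanced_measures e R nu by rewrite -cover; exists S.
apply: (TQ S TS); apply: extreme_mem_convex_hull muS => a b k aS bS k0 k1 muE.
have mix_basic : basic e (k%:num *: a + (1 - k%:num) *: b).
  by move: mu_basic; rewrite muE.
apply: basic_extreme mix_basic k0 k1 _ => t t0 t1; apply: hull_bal.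
have t01 : Itv.spec (@Itv.num_sem R) (Itv.Real `[0%Z, 1%Z]) t.
  by rewrite /= /Itv.num_sem /= in_itv /= t0 t1 ger0_real.
by apply/set_mem/(convex_convex_hull _ _ _ _ _ (Itv.mk t01)); apply/mem_set.
Qed.
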